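(* Let $\mathbb{K}$ be a field and let $\mathcal{C}$ be a $d$-clutter on vertex set $[n]$ obtained from $K_n^d$ by removing a sequence of exposed circuits $(e_1, e_2, \dots, e_r)$. Let $(K_n^d = \mathcal{C}_1, \mathcal{C}_2, \dots, \mathcal{C}_{r+1} = \mathcal{C})$ be the sequence of $d$-clutters obtained in this process, so that $\mathcal{C}_{j+1}=\mathcal{C}_j\setminus\{e_j\}$ and $e_j$ is exposed in $\mathcal{C}_j$ for $j=1,\dots,r$. Let $K_j$ be the unique maximal clique of $\mathcal{C}_j$ containing $e_j$, and let $k_j = n-|K_j|$. Then for all $i\ge 0$ the Betti numbers of $I_{\overline{\mathcal{C}}}\subset R=\mathbb{K}[x_1,\dots,x_n]$ are given by $$\beta_i(I_{\overline{\mathcal{C}}}) = \sum_{j=1}^r \binom{k_j}{i}.$$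
   Context: A $d$-clutter ($d\ge1$) on $[n]=\{1,\dots,n\}$ is a collection $\mathcal{C}$ of $d$-element subsets of $[n]$, called circuits. The complete $d$-clutter $K_n^d$ consists of all $d$-subsets of $[n]$. The complement $\overline{\mathcal{C}}$ consists of all $d$-subsets of $[n]$ not in $\mathcal{C}$. A clique of $\mathcal{C}$ is a nonempty $S \subset [n]$ such that either $|S|<d$, or $|S|\ge d$ and every $d$-subset of $S$ is a circuit of $\mathcal{C}$; it is maximal if it is maximal under inclusion among cliques. A circuit $e\in\mathcal{C}$ is exposed if it is contained in a unique maximal clique of $\mathcal{C}$. For $e=\{v_1,\dots,v_d\}$, $\mathbf{x}_e = x_{v_1}\cdots x_{v_d}$, and the circuit ideal of a $d$-clutter $\mathcal{D}$ is $I_{\mathcal{D}} = \langle \mathbf{x}_f : f\in\mathcal{D}\rangle\subset R$. The (total) Betti numbers of a graded ideal $I$, regarded as an $R$-module, are $\beta_i(I)=\dim_{\mathbb{K}}\operatorname{Tor}_i^R(I,\mathbb{K})$. *)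

(* Defs.v *)
From HB Require Import structures.
From mathcomp Require Import all_boot all_order all_algebra.
From mathcomp Require Import mpoly.

Set Implicit Arguments.
Unset Strict Implicit.
Unset Printing Implicit Defensive.

Import GRing.Theory.
Local Open Scope ring_scope.

(* The vertex set [n] is 'I_n; a clutter is its set of circuits. *)

Definition complete_clutter (n d : nat) : {set {set 'I_n}} :=
  [set f : {set 'I_n} | #|f| == d].

Definition clutter_compl (n d : nat) (C : {set {set 'I_n}}) : {set {set 'I_n}} :=
  complete_clutter n d :\: C.

Definition clique (n d : nat) (C : {set {set 'I_n}}) (S : {set 'I_n}) : bool :=
  (S != set0) &&
  ((#|S| < d)%N ||
   (d <= #|S|)%N &&
     [forall f : {set 'I_n}, (f \subset S) && (#|f| == d) ==> (f \in C)]).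

Definition maximal_clique (n d : nat) (C : {set {set 'I_n}}) (S : {set 'I_n}) :
    bool :=
  maxset (clique d C) S.

Definition exposed (n d : nat) (C : {set {set 'I_n}}) (e : {set 'I_n}) : Prop :=
  e \in C /\ exists! S : {set 'I_n}, maximal_clique d C S /\ e \subset S.

Definition circuit_ideal (K : fieldType) (n : nat) (D : {set {set 'I_n}})
    (p : {mpoly K[n]}) : Prop :=
  exists c : {set 'I_n} -> {mpoly K[n]},
    p = \sum_(f in D) c f * \prod_(v in f) 'X_v.
Arguments circuit_ideal K {n} D p.

(* A resolution  ... -> F_2 -> F_1 -> F_0 -> I -> 0  of an ideal I of
   R = K[x_1, ..., x_n] by free modules F_i = R^(res_rank i) of finite rank,
   whose elements are row vectors on which matrices act from the right.  The
   augmentation F_0 -> I is composed with the inclusion of I in R. *)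
Record free_resolution (K : fieldType) (n : nat) (I : {mpoly K[n]} -> Prop) :=
  FreeResolution {
    res_rank : nat -> nat;
    res_aug : 'M[{mpoly K[n]}]_(res_rank 0, 1);
    res_diff : forall i, 'M[{mpoly K[n]}]_(res_rank i.+1, res_rank i);
    res_aug_image : forall p : {mpoly K[n]},
      I p <-> exists v : 'rV_(res_rank 0), v *m res_aug = p%:M;
    res_exact0 : forall v : 'rV_(res_rank 0),
      v *m res_aug = 0 <-> exists w : 'rV_(res_rank 1), v = w *m res_diff 0;
    res_exactS : forall i (v : 'rV_(res_rank i.+1)),
      v *m res_diff i = 0 <->
      exists w : 'rV_(res_rank i.+2), v = w *m res_diff i.+1
  }.

(* The differential F_(i+1) (x)_R K -> F_i (x)_R K, where K = R/(x_1, ..., x_n):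
   the entries are reduced to their constant coefficients. *)
Definition res_diffK (K : fieldType) (n : nat) (I : {mpoly K[n]} -> Prop)
    (F : free_resolution I) (i : nat) : 'M[K]_(res_rank F i.+1, res_rank F i) :=
  map_mx (mcoeff 0%MM) (res_diff F i).

(* dim_K H_i(F (x)_R K).  Images lie in kernels, so the subtractions are never
   truncated. *)
Definition tor_dim (K : fieldType) (n : nat) (I : {mpoly K[n]} -> Prop)
    (F : free_resolution I) (i : nat) : nat :=
  match i with
  | 0 => res_rank F 0 - \rank (res_diffK F 0)
  | j.+1 => \rank (kermx (res_diffK F j)) - \rank (res_diffK F j.+1)
  end%N.

(* beta_i(I) = b, that is dim_K Tor_i^R(I, K) = b.  Asking both for a resolution
   to exist and for every resolution to give b means that this formulation does
   not presuppose that Tor is well defined. *)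
Definition betti_number (K : fieldType) (n : nat) (I : {mpoly K[n]} -> Prop)
    (i b : nat) : Prop :=
  inhabited (free_resolution I) /\
  forall F : free_resolution I, tor_dim F i = b.

(* Main.v *)
(** The removed circuits give linear quotients.  If S is the unique maximal clique
  of C containing the exposed circuit e, then (I : x_e) = (x_v : v \notin S), where
  I is the circuit ideal of the complement of C: for v \notin S the set e + v is not
  a clique, so it contains a generator x_f of I and x_f divides x_e x_v; conversely
  no generator of I is supported in S, so setting x_v = 0 for v \notin S kills I and
  fixes x_e.  Adjoining x_e to I therefore changes a linear resolution by a mapping
  cone with the Koszul complex on the variables outside S, and the cone is again
  linear, hence minimal.  The Koszul complexes are iterated cones of the same kind,
  since (x_v : v \in A) : x_w = (x_v : v \in A) when w \notin A.  Any two
  resolutions being homotopy equivalent, a minimal one computes the Betti numbers. *)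
Require Import Defs.
From mathcomp Require Import all_boot all_order all_algebra.
From mathcomp Require Import mpoly.
From Stdlib Require Import IndefiniteDescription.

Set Implicit Arguments.
Unset Strict Implicit.
Unset Printing Implicit Defensive.

Import GRing.Theory.
Local Open Scope ring_scope.

(** * Dependent choice and a rank computation *)

(** Builds chain maps and homotopies degree by degree; the invariant [P] records that the
    construction can go on. *)
Lemma dependent_choice (T : nat -> Type) (P : forall i, T i -> Prop)
    (Q : forall i, T i -> T i.+1 -> Prop) (x0 : T 0) :
  P 0 x0 -> (forall i x, P i x -> exists2 y, P i.+1 y & Q i x y) ->
  exists2 f : forall i, T i, f 0 = x0 & forall i, Q i (f i) (f i.+1).
Proof.
move=> P0 step.
have next i (x : {x | P i x}) :
    {y : {y | P i.+1 y} | Q i (sval x) (sval y)}.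
  apply: constructive_indefinite_description.
  by have [y Py Qxy] := step i _ (svalP x); exists (exist _ y Py).
pose f := fix f i : {x | P i x} :=
  if i is j.+1 then sval (next j (f j)) else exist _ x0 P0.
exists (fun i => sval (f i)) => // i.
exact: svalP (next i (f i)).
Qed.

(** The data is a homotopy equivalence, at one spot, with a complex whose differential is zero. The
    homotopy puts [kermx A] inside [B + g], and [g *m f = 1] with [B *m f = 0] makes this sum
    direct. *)
Lemma homology_rank (K : fieldType) (a m b k : nat) (A : 'M[K]_(m, a))
    (B : 'M_(b, m)) (f : 'M_(m, k)) (g : 'M_(k, m))
    (h : 'M_(m, b)) (h' : 'M_(a, m)) :
  B *m A = 0 -> B *m f = 0 -> g *m A = 0 -> g *m f = 1%:M ->
  f *m g - 1%:M = h *m B + A *m h' ->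
  (\rank (kermx A) - \rank B)%N = k.
Proof.
move=> BA Bf gA gf fg.
have rg : \rank g = k.
  apply/eqP; rewrite -[_ == _]/(row_free g); apply/row_freeP.
  by exists f.
have dis : (B :&: g)%MS = 0.
  apply/eqP; rewrite -submx0; apply/rV_subP => v.
  rewrite sub_capmx => /andP[/submxP[x ->] /submxP[y xy]].
  have y0 : y = 0 by rewrite -[y]mulmx1 -gf mulmxA -xy -mulmxA Bf mulmx0.
  by rewrite xy y0 mul0mx sub0mx.
have -> : \rank (kermx A) = \rank (B + g)%MS.
  apply/eqmx_rank/andP; split; last first.
    by rewrite addsmx_sub; apply/andP; split; apply/sub_kermxP.
  apply/rV_subP => v /sub_kermxP vA.
  have -> : v = v *m f *m g - v *m h *m B.
    have := congr1 (mulmx v) fg.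
    rewrite mulmxBr mulmxDr mulmx1 !mulmxA vA mul0mx addr0 => <-.
    by rewrite opprB addrC subrK.
  rewrite addrC -mulNmx; apply: addmx_sub_adds; exact: submxMl.
by rewrite mxrank_disjoint_sum // rg addKn.
Qed.

(** * Free resolutions and lifting through exact sequences *)

Section Resolutions.

Variables (K : fieldType) (n : nat).
Local Notation R := {mpoly K[n]}.
Implicit Types I J : R -> Prop.

Section Exactness.

Variables (I : R -> Prop) (F : free_resolution I).

(** A matrix is a map out of a free module, so it is lifted one row at a time. *)
Lemma res_exact0_mx k (V : 'M_(k, res_rank F 0)) :
  V *m res_aug F = 0 -> exists W, V = W *m res_diff F 0.
Proof.
move=> V0; have rowE i : exists w, row i V = w *m res_diff F 0.
  by apply/res_exact0; rewrite -row_mul V0 row0.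
have [w wE] := fin_all_exists rowE.
exists (\matrix_i w i); apply/row_matrixP => i.
by rewrite row_mul rowK wE.
Qed.

Lemma res_exactS_mx i k (V : 'M_(k, res_rank F i.+1)) :
  V *m res_diff F i = 0 -> exists W, V = W *m res_diff F i.+1.
Proof.
move=> V0; have rowE j : exists w, row j V = w *m res_diff F i.+1.
  by apply/res_exactS; rewrite -row_mul V0 row0.
have [w wE] := fin_all_exists rowE.
exists (\matrix_j w j); apply/row_matrixP => j.
by rewrite row_mul rowK wE.
Qed.

Lemma res_aug_image_mx k (V : 'M_(k, 1)) :
  (forall i, I (V i 0)) -> exists W, V = W *m res_aug F.
Proof.
move=> IV; have rowE i : exists w, row i V = w *m res_aug F.
  have [w wE] := (res_aug_image F _).1 (IV i).
  by exists w; rewrite wE; apply/rowP => j; rewrite !mxE !ord1 eqxx.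
have [w wE] := fin_all_exists rowE.
exists (\matrix_j w j); apply/row_matrixP => j.
by rewrite row_mul rowK wE.
Qed.

Lemma res_diff_aug : res_diff F 0 *m res_aug F = 0.
Proof.
apply/row_matrixP => i; rewrite row_mul row0.
by apply/res_exact0; exists (delta_mx 0 i); rewrite rowE.
Qed.

Lemma res_diff_diff i : res_diff F i.+1 *m res_diff F i = 0.
Proof.
apply/row_matrixP => j; rewrite row_mul row0.
by apply/res_exactS; exists (delta_mx 0 j); rewrite rowE.
Qed.

Lemma res_aug_in i : I (res_aug F i 0).
Proof.
apply/(res_aug_image F); exists (delta_mx 0 i); rewrite -rowE.
by apply/rowP => j; rewrite !mxE !ord1 eqxx.
Qed.

End Exactness.

(** * Chain maps and homotopies *)

(** A lift of multiplication by [m] from [J] to [I]: the case [m = 1] compares resolutions, the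
    general case feeds the mapping cone. *)
Definition chain_map I J (G : free_resolution J) (F : free_resolution I) (m : R)
    (psi : forall i, 'M[R]_(res_rank G i, res_rank F i)) : Prop :=
  psi 0 *m res_aug F = m *: res_aug G /\
  forall i, psi i.+1 *m res_diff F i = res_diff G i *m psi i.

Lemma chain_map_exists I J (G : free_resolution J) (F : free_resolution I) m :
  (forall p, J p -> I (m * p)) -> exists psi, @chain_map I J G F m psi.
Proof.
move=> JI.
have [psi0 psi0E] : exists W, m *: res_aug G = W *m res_aug F.
  apply: res_aug_image_mx => i; rewrite mxE.
  by apply: JI; apply: res_aug_in.
(* The invariant says that [f] extends one degree further; exactness restores it for the
   extension. *)
have [] := @dependent_choice
  (fun i => 'M[R]_(res_rank G i, res_rank F i))
  (fun i f => exists W, W *m res_diff F i = res_diff G i *m f)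
  (fun i f f' => f' *m res_diff F i = res_diff G i *m f) psi0.
- have [|W WE] := @res_exact0_mx _ F _ (res_diff G 0 *m psi0); last by exists W.
  by rewrite -mulmxA -psi0E -scalemxAr res_diff_aug scaler0.
- move=> i f [W WE]; exists W => //.
  have [|W' W'E] := @res_exactS_mx _ F i _ (res_diff G i.+1 *m W).
    by rewrite -mulmxA WE mulmxA res_diff_diff mul0mx.
  by exists W'.
by move=> f f0 fS; exists f; split=> //; rewrite f0.
Qed.

Lemma chain_map_comp I (F G : free_resolution I) (f g : forall i, _) :
  @chain_map I I F G 1 f -> @chain_map I I G F 1 g ->
  chain_map (F := F) (G := F) 1 (fun i => f i *m g i).
Proof.
move=> [f0 fS] [g0 gS]; split; first by rewrite -mulmxA g0 scale1r f0.
by move=> i; rewrite -mulmxA gS !mulmxA fS.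
Qed.

(** [f - 1] lifts the zero map of [I], hence is null-homotopic. *)
Lemma chain_map_homotopy I (F : free_resolution I) (f : forall i, _) :
  @chain_map I I F F 1 f ->
  exists h : forall i, 'M[R]_(res_rank F i, res_rank F i.+1),
    f 0 - 1%:M = h 0 *m res_diff F 0 /\
    forall i, f i.+1 - 1%:M = h i.+1 *m res_diff F i.+1 + res_diff F i *m h i.
Proof.
move=> [f0 fS].
have [h0 h0E] : exists W, f 0 - 1%:M = W *m res_diff F 0.
  by apply: res_exact0_mx; rewrite mulmxBl f0 mul1mx scale1r subrr.
(* The invariant on [h] says exactly that [f i.+1 - 1 - res_diff F i *m h] is a cycle, so the next
   component exists. *)
have [] := @dependent_choice
  (fun i => 'M[R]_(res_rank F i, res_rank F i.+1))
  (fun i h => res_diff F i *m (f i - 1%:M - h *m res_diff F i) = 0)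
  (fun i h h' => f i.+1 - 1%:M = h' *m res_diff F i.+1 + res_diff F i *m h) h0.
- by rewrite -h0E subrr mulmx0.
- move=> i h hP.
  have [|W WE] := @res_exactS_mx _ F i _ (f i.+1 - 1%:M - res_diff F i *m h).
    rewrite !mulmxBl fS mul1mx -mulmxA.
    by move: hP; rewrite !mulmxBr mulmx1.
  have fE : f i.+1 - 1%:M = W *m res_diff F i.+1 + res_diff F i *m h.
    by rewrite -WE subrK.
  exists W => //.
  by rewrite fE addrAC subrr add0r mulmxA res_diff_diff mul0mx.
by move=> h h0' hS; exists h; rewrite h0'.
Qed.

(** * Betti numbers from a minimal resolution *)

Definition minimal_resolution I (F : free_resolution I) : Prop :=
  forall i, res_diffK F i = 0.

Local Notation mod_max := (map_mx (mcoeff (R := K) (n := n) 0%MM)).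

Lemma minimal_betti I (L : free_resolution I) i :
  minimal_resolution L -> betti_number I i (res_rank L i).
Proof.
move=> minL; split; first by constructor.
move=> F.
have idI p : I p -> I (1 * p) by rewrite mul1r.
have [f fP] := chain_map_exists F L idI.
have [g gP] := chain_map_exists L F idI.
have [h [h0 hS]] := chain_map_homotopy (chain_map_comp fP gP).
have [h' [h'0 h'S]] := chain_map_homotopy (chain_map_comp gP fP).
pose fK j := mod_max (f j); pose gK j := mod_max (g j).
pose hK j := mod_max (h j).
(* On [L] every term of the homotopy contains a differential of [L], which vanishes modulo the
   variables. *)
have gfK j : gK j *m fK j = 1%:M.
  apply/eqP; rewrite -subr_eq0 -(map_mx1 (@mcoeff n K 0%MM)) -map_mxM -map_mxB /=.
  case: j => [|j]; first by rewrite h'0 map_mxM [X in _ *m X]minL mulmx0.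
  rewrite h'S map_mxD !map_mxM [X in _ *m X + _]minL.
  by rewrite [X in _ + X *m _]minL mulmx0 mul0mx addr0.
have dfK j : res_diffK F j *m fK j = 0.
  by rewrite -map_mxM -fP.2 map_mxM [X in _ *m X]minL mulmx0.
have gdK j : gK j.+1 *m res_diffK F j = 0.
  by rewrite -map_mxM gP.2 map_mxM [X in X *m _]minL mul0mx.
case: i => [|i] /=.
  (* In degree 0 the outgoing map has target of dimension 0, so its kernel is everything. *)
  have := @homology_rank K 0 _ _ _ 0 (res_diffK F 0) (fK 0) (gK 0) (hK 0) 0.
  rewrite mxrank_ker mxrank0 subn0; apply; rewrite ?mulmx0 ?addr0 //.
  by rewrite -(map_mx1 (@mcoeff n K 0%MM)) -!map_mxM -map_mxB h0.
apply: (@homology_rank K _ _ _ _ _ _ (fK i.+1) (gK i.+1) (hK i.+1) (hK i)) => //.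
  by rewrite -map_mxM res_diff_diff map_mx0.
by rewrite -(map_mx1 (@mcoeff n K 0%MM)) -!map_mxM -map_mxB hS map_mxD !map_mxM.
Qed.

(** * Graded components and linear resolutions *)

Definition homog_mx k a b (A : 'M[R]_(a, b)) : Prop :=
  forall i j, A i j \is k.-homog.

Definition linear_resolution d I (F : free_resolution I) : Prop :=
  homog_mx d (res_aug F) /\ forall i, homog_mx 1 (res_diff F i).

Lemma linear_minimal d I (F : free_resolution I) :
  linear_resolution d F -> minimal_resolution F.
Proof.
move=> [_ dF] i; apply/matrixP => a b; rewrite !mxE.
by apply: dhomog_nemf_coeff (dF i a b) _; rewrite mf0.
Qed.

(** Multiplication by a form of degree [d] shifts degrees by [d]; by linearity in [p] a monomial
    suffices. Through this, graded components of a lift pass across homogeneous matrices. *)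
Lemma pihomogMr e d (p q : R) : q \is d.-homog ->
  pihomog mdeg (e + d) (p * q) = pihomog mdeg e p * q.
Proof.
move=> qd; elim/mpolyind: p => [|c m p _ _ IH].
  by rewrite mul0r !linear0 mul0r.
rewrite mulrDl !linearD /= IH mulrDl; congr (_ + _).
rewrite -scalerAl !linearZ /= -scalerAl pihomogX; congr (_ *: _).
have mqd : 'X_[m] * q \is (mdeg m + d).-homog by apply: dhomogM; rewrite ?dhomogX.
have [<-|ne] := eqVneq (mdeg m) e; first exact: pihomog_dE.
by rewrite mul0r; apply: pihomog_ne0 mqd; rewrite eqn_add2r.
Qed.

Local Notation part k := (map_mx (pihomog (R := K) (n := n) mdeg k)).

Lemma part_mulmxl e d a b c (A : 'M[R]_(a, b)) (B : 'M_(b, c)) :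
  homog_mx d B -> part (e + d) (A *m B) = part e A *m B.
Proof.
move=> Bd; apply/matrixP => i j; rewrite !mxE linear_sum.
by apply: eq_bigr => k _; rewrite /= mxE pihomogMr.
Qed.

Lemma part_mulmxr e d a b c (A : 'M[R]_(a, b)) (B : 'M_(b, c)) :
  homog_mx d A -> part (d + e) (A *m B) = A *m part e B.
Proof.
move=> Ad; apply/matrixP => i j; rewrite !mxE linear_sum.
by apply: eq_bigr => k _; rewrite /= mxE mulrC addnC pihomogMr // mulrC.
Qed.

Lemma linear_chain_map d I J (G : free_resolution J) (F : free_resolution I) m :
  linear_resolution 1 G -> linear_resolution d F -> m \is d.-homog ->
  (forall p, J p -> I (m * p)) ->
  exists2 psi, @chain_map I J G F m psi & forall i, homog_mx 1 (psi i).
Proof.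
move=> [aG dG] [aF dF] md /(chain_map_exists G F) [psi [psi0 psiS]].
(* Degree-1 components of an arbitrary lift still commute with the linear
   differentials. *)
exists (fun i => part 1 (psi i)); last by move=> i a b; rewrite mxE pihomogP.
split=> [|i]; last by rewrite -(part_mulmxl _ _ (dF i)) psiS (part_mulmxr _ _ (dG i)).
rewrite -(part_mulmxl _ _ aF) psi0; apply/matrixP => a b; rewrite !mxE.
by apply: pihomog_dE; rewrite addnC; apply: dhomogM.
Qed.

Definition has_linear_resolution d I (b : nat -> nat) : Prop :=
  exists2 F : free_resolution I, linear_resolution d F & res_rank F =1 b.

Lemma zero_linear_resolution d I :
  (forall p, I p <-> p = 0) -> has_linear_resolution d I (fun=> 0%N).
Proof.
move=> I0.
unshelve eexists (@FreeResolution K n I (fun=> 0%N) 0 (fun=> 0) _ _ _).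
- move=> p; rewrite I0; split=> [->|[v]]; first by exists 0; rewrite mul0mx raddf0.
  by rewrite mulmx0 => /(congr1 (fun A : 'M_1 => A 0 0)); rewrite !mxE.
- by move=> v; split=> [_|_]; [exists 0|rewrite mulmx0]; rewrite ?[v]thinmx0 ?mul0mx.
- by move=> i v; split=> [_|_]; [exists 0|rewrite mulmx0]; rewrite ?[v]thinmx0 ?mul0mx.
- by split=> [[]|i []].
by [].
Qed.

(** * The mapping cone for adjoining one generator *)

Section MappingCone.

Variables (I J : R -> Prop) (F : free_resolution I) (G : free_resolution J).
Variables (m : R) (psi : forall i, 'M[R]_(res_rank G i, res_rank F i)).

Hypothesis colon : forall p, I (m * p) <-> J p.
Hypothesis psiP : chain_map m psi.

(* [quot_rank] and [quot_diff] resolve R/J: G shifted by one, with R in degree 0. *)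
Definition quot_rank i := if i is j.+1 then res_rank G j else 1%N.

Definition quot_diff i : 'M[R]_(quot_rank i.+1, quot_rank i) :=
  match i return 'M[R]_(quot_rank i.+1, quot_rank i) with
  | 0 => res_aug G
  | j.+1 => res_diff G j
  end.

Definition cone_rank i := (res_rank F i + quot_rank i)%N.

Definition cone_aug : 'M[R]_(cone_rank 0, 1) := col_mx (res_aug F) m%:M.

(** [G] in degree [i] sits in cone degree [i.+1], so [psi i] lowers the degree by one. The sign
    makes the two off-diagonal terms of the squared differential cancel. *)
Definition cone_diff i : 'M[R]_(cone_rank i.+1, cone_rank i) :=
  block_mx (res_diff F i) 0 (psi i) (- quot_diff i).

Lemma quot_exact i (v : 'rV_(quot_rank i.+1)) :
  v *m quot_diff i = 0 <-> exists w : 'rV_(quot_rank i.+2), v = w *m quot_diff i.+1.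
Proof. by case: i v => [|i] v; [apply: res_exact0|apply: res_exactS]. Qed.

Lemma cone_aug_image I' :
  (forall p, I' p <-> exists a, I (p - m * a)) ->
  forall p, I' p <-> exists v : 'rV_(cone_rank 0), v *m cone_aug = p%:M.
Proof.
move=> I'E p; rewrite I'E; split=> [[a /(res_aug_image F) [u uE]]|[v]].
  exists (row_mx u a%:M); rewrite mul_row_col uE -scalar_mxM -raddfD /=.
  by rewrite [a * m]mulrC subrK.
rewrite -[v]hsubmxK mul_row_col [rsubmx v]mx11_scalar -scalar_mxM => /eqP.
set a := rsubmx v 0 0; rewrite eq_sym -subr_eq => /eqP vE.
exists a; apply/(res_aug_image F); exists (lsubmx v).
by rewrite -vE -raddfB /= [a * m]mulrC.
Qed.

(** For a cycle [(u, a)], [m * a] lies in [I], so [a] lies in [J] and equals [w *m res_aug G]; then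
    [u + w *m psi 0] is a cycle of [F]. *)
Lemma cone_exact0 (v : 'rV_(cone_rank 0)) :
  v *m cone_aug = 0 <-> exists w : 'rV_(cone_rank 1), v = w *m cone_diff 0.
Proof.
split=> [|[w ->]]; last first.
  rewrite -mulmxA mul_block_col mul0mx addr0 res_diff_aug psiP.1 mul_mx_scalar.
  by rewrite scalerN subrr col_mx0 mulmx0.
rewrite -[v]hsubmxK mul_row_col; set u := lsubmx v; set a := rsubmx v.
rewrite mul_mx_scalar => ua0.
have /colon/(res_aug_image G)[w wE] : I (m * a 0 0).
  apply/(res_aug_image F); exists (- u); rewrite mulNmx -[LHS]addr0 -ua0 addKr.
  by rewrite [a]mx11_scalar scale_scalar_mx !mxE eqxx.
have aE : a = w *m quot_diff 0 by rewrite wE -mx11_scalar.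
have [|u' u'E] := (@res_exact0 _ _ _ F (u + w *m psi 0)).1.
  by rewrite mulmxDl -mulmxA psiP.1 -scalemxAr -[w *m _]aE.
(* The sign of [- w] offsets the one in [cone_diff]. *)
exists (row_mx u' (- w)); rewrite mul_row_block -u'E mulmx0 add0r.
by rewrite !mulNmx mulmxN opprK addrK aE.
Qed.

Lemma cone_exactS i (v : 'rV_(cone_rank i.+1)) :
  v *m cone_diff i = 0 <->
  exists w : 'rV_(cone_rank i.+2), v = w *m cone_diff i.+1.
Proof.
have dd : quot_diff i.+1 *m quot_diff i = 0.
  by case: i {v} => [|i]; [apply: res_diff_aug|apply: res_diff_diff].
split=> [|[w ->]]; last first.
  rewrite -mulmxA mulmx_block !mulmx0 !mul0mx !add0r res_diff_diff addr0.
  by rewrite psiP.2 mulNmx subrr mulNmx mulmxN dd !oppr0 block_mx_const mulmx0.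
rewrite -[v]hsubmxK mul_row_block; set u := lsubmx v; set a := rsubmx v.
rewrite mulmx0 add0r mulmxN -row_mx0 => /eq_row_mx [ua0 /eqP].
rewrite oppr_eq0 => /eqP/quot_exact [w aE].
have [|u' u'E] := (@res_exactS _ _ _ F i (u + w *m psi i.+1)).1.
  by rewrite mulmxDl -mulmxA psiP.2 mulmxA -[w *m _]aE.
exists (row_mx u' (- w)); rewrite mul_row_block -u'E mulmx0 add0r.
by rewrite !mulNmx mulmxN opprK addrK aE.
Qed.

End MappingCone.

(** Here [J = I : m] and [I' = I + (m)]. The new blocks of the differential are linear: [psi] can be
    chosen so, and [J] is generated by linear forms. The rank [1] in degree 0 is the generator
    [m]. *)
Lemma linear_resolution_cone d I I' J m (b c : nat -> nat) :
  m \is d.-homog -> (forall p, I (m * p) <-> J p) ->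
  (forall p, I' p <-> exists a, I (p - m * a)) ->
  has_linear_resolution d I b -> has_linear_resolution 1 J c ->
  has_linear_resolution d I'
    (fun i => b i + (if i is j.+1 then c j else 1))%N.
Proof.
move=> md colon I'E [F linF Fb] [G linG Gc].
have [psi psiP psi1] := linear_chain_map linG linF md (fun p => (colon p).2).
exists (FreeResolution (cone_aug_image F G I'E) (cone_exact0 colon psiP)
                       (cone_exactS psiP)).
- case: linF linG => [aF dF] [aG dG]; split=> /=.
    move=> i j; rewrite mxE; case: split => k; first exact: aF.
    by rewrite !ord1 mxE eqxx.
  move=> i k l; rewrite mxE; case: split => k'; rewrite mxE; case: split => l'.
  + exact: dF.
  + by rewrite mxE dhomog0.
  + exact: psi1.
  + by case: i k l k' l' => [|i] k l k' l'; rewrite mxE dhomogN; [apply: aG|apply: dG].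
- by move=> [|i] /=; rewrite /cone_rank /= Fb ?Gc.
Qed.

Lemma eq_linear_resolution d I b b' :
  b =1 b' -> has_linear_resolution d I b -> has_linear_resolution d I b'.
Proof. by move=> bb' [F linF Fb]; exists F => // i; rewrite Fb bb'. Qed.

Lemma linear_resolution_betti d I b i :
  has_linear_resolution d I b -> betti_number I i (b i).
Proof. by move=> [F /linear_minimal minF <-]; apply: minimal_betti. Qed.

(** * Ideals generated by variables and their Koszul resolutions *)

(* The kernel of [kill A] is the ideal (x_v : v \in A). *)
Definition kill (A : {set 'I_n}) : {rmorphism R -> R} :=
  comp_mpoly [tuple (if v \in A then 0 else 'X_v) | v < n].

Lemma killX A v : kill A 'X_v = if v \in A then 0 else 'X_v.
Proof. by rewrite /= comp_mpolyXU -tnth_nth tnth_mktuple. Qed.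

Lemma mpoly_alg_ind (P : R -> Prop) :
  (forall c, P c%:MP) -> (forall v, P 'X_v) ->
  (forall p q, P p -> P q -> P (p + q)) ->
  (forall p q, P p -> P q -> P (p * q)) ->
  forall p, P p.
Proof.
move=> PC PX PD PM; elim/mpolyind => [|c m p _ _ Pp].
  by rewrite -(mpolyC0 n K).
apply: PD => //; rewrite -mul_mpolyC; apply: (PM) => //.
rewrite mpolyXE_id; apply: big_ind => [||v _]; [by rewrite -(mpolyC1 n K)|exact: PM|].
by elim: (m v) => [|k IH]; [rewrite expr0 -(mpolyC1 n K)|rewrite exprS; apply: PM].
Qed.

Lemma kill0 p : kill set0 p = p.
Proof.
elim/mpoly_alg_ind: p => [c|v|p q Ep Eq|p q Ep Eq].
- exact: comp_mpolyC.
- by rewrite killX inE.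
- by rewrite rmorphD /= Ep Eq.
- by rewrite rmorphM /= Ep Eq.
Qed.

Lemma killU A B p : kill A (kill B p) = kill (B :|: A) p.
Proof.
elim/mpoly_alg_ind: p => [c|v|p q Ep Eq|p q Ep Eq].
- by rewrite /= !comp_mpolyC.
- by rewrite !killX inE; case: ifP => _; rewrite ?rmorph0 ?killX.
- by rewrite !rmorphD /= Ep Eq.
- by rewrite !rmorphM /= Ep Eq.
Qed.

(** Division by ['X_v], the remainder being free of that variable. *)
Lemma kill1_sub v p : exists a, p = 'X_v * a + kill [set v] p.
Proof.
elim/mpoly_alg_ind: p => [c|w|p q [a Ep] [b Eq]|p q [a Ep] [b Eq]].
- by exists 0; rewrite mulr0 add0r /= comp_mpolyC.
- rewrite killX inE; case: eqP => [->|_]; last by exists 0; rewrite mulr0 add0r.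
  by exists 1; rewrite mulr1 addr0.
- exists (a + b); rewrite rmorphD /= {1}Ep {1}Eq mulrDr.
  by rewrite addrACA.
(* Only [p] is expanded at first: its quotient part multiplies all of [q], its remainder multiplies
   the expansion of [q]. *)
- exists (a * q + kill [set v] p * b); rewrite rmorphM /= {1}Ep mulrDl.
  rewrite {2}Eq !mulrDr !mulrA -!addrA; congr (_ + _); congr (_ + _).
  by rewrite ['X_v * _]mulrC.
Qed.

Lemma killU1_eq0 v A p :
  kill (v |: A) p = 0 <-> exists a, kill A (p - 'X_v * a) = 0.
Proof.
rewrite -killU; split=> [|[a]].
  have [a pE] := kill1_sub v p => pA0; exists a.
  by rewrite {1}pE addrAC subrr add0r.
rewrite rmorphB => /eqP; rewrite subr_eq0 => /eqP pE.
rewrite killU setUC -killU pE killU setUC.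
by rewrite rmorphM killX !inE eqxx mul0r.
Qed.

(** Koszul ranks, shifted by one because the ideal is resolved and not the quotient. Removing [v]
    from [A] gives a cone with [I] and [J] both the ideal of [A :\ v]. *)
Lemma linear_resolution_vars A :
  has_linear_resolution 1 (fun p => kill A p = 0) (fun i => 'C(#|A|, i.+1)).
Proof.
have [k] := ubnP #|A|; elim: k A => // k IH A; rewrite ltnS => cardA.
have [->|[v vA]] := set_0Vmem A.
  rewrite cards0; apply: eq_linear_resolution (zero_linear_resolution _ _) => //.
  by move=> p; rewrite kill0.
have := cardsD1 v A; rewrite vA add1n => cA.
have resAv := IH (A :\ v) (leq_trans (eq_leq (esym cA)) cardA).
apply: (@eq_linear_resolution _ _ (fun i => 'C(#|A :\ v|, i.+1) +
    (if i is j.+1 then 'C(#|A :\ v|, j.+1) else 1))%N).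
  by move=> [|i]; rewrite cA binS ?bin0 ?bin1.
apply: (linear_resolution_cone (m := 'X_v) _ _ _ resAv resAv).
- by rewrite dhomogX; apply/eqP; exact: mdeg1.
(* As [v] is outside [A :\ v], [kill] fixes the nonzero ['X_v], which cancels in a domain. *)
- move=> p; rewrite rmorphM killX !inE eqxx /=; split=> [/eqP|->]; last by rewrite mulr0.
  by rewrite mulf_eq0 -msupp_eq0 msuppX => /eqP.
- by move=> p; rewrite -{1}(setD1K vA) killU1_eq0.
Qed.

End Resolutions.

(** * Circuit ideals, cliques and the colon by an exposed circuit *)

Section Clutters.

Variables (K : fieldType) (n d : nat).
Implicit Types (C D : {set {set 'I_n}}) (e f S : {set 'I_n}).

Lemma circuit_ideal0 (p : {mpoly K[n]}) : circuit_ideal K set0 p <-> p = 0.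
Proof.
split=> [[c ->]|->]; first by rewrite big_set0.
by exists (fun=> 0); rewrite big_set0.
Qed.

(** Gives the sum of an ideal and a principal ideal in the form that the cone expects. *)
Lemma circuit_ideal1U D e (p : {mpoly K[n]}) : e \notin D ->
  circuit_ideal K (e |: D) p <->
  exists a, circuit_ideal K D (p - \prod_(v in e) 'X_v * a).
Proof.
move=> eD; split=> [[c ->]|[a [c pE]]].
  exists (c e); exists c; rewrite big_setU1 //= [c e * _]mulrC.
  by rewrite addrAC subrr add0r.
exists (fun f => if f == e then a else c f).
rewrite big_setU1 //= eqxx -[LHS](subrK (\prod_(v in e) 'X_v * a)) pE addrC.
rewrite [a * _]mulrC; congr (_ + _); apply: eq_bigr => f fD.
by case: eqP => // fe; rewrite -fe fD in eD.
Qed.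

Lemma circuit_ideal_mull D (p q : {mpoly K[n]}) :
  circuit_ideal K D p -> circuit_ideal K D (q * p).
Proof.
move=> [c ->]; exists (fun f => q * c f); rewrite mulr_sumr.
by apply: eq_bigr => f _; rewrite mulrA.
Qed.

Lemma circuit_idealD D (p q : {mpoly K[n]}) :
  circuit_ideal K D p -> circuit_ideal K D q -> circuit_ideal K D (p + q).
Proof.
move=> [a ->] [b ->]; exists (fun f => a f + b f); rewrite -big_split.
by apply: eq_bigr => f _; rewrite mulrDl.
Qed.

Lemma circuit_ideal_gen D f : f \in D ->
  circuit_ideal K D (\prod_(v in f) 'X_v).
Proof.
move=> fD; exists (fun g => (g == f)%:R); rewrite (bigD1 f) //= eqxx mul1r.
by rewrite [X in _ + X]big1 ?addr0 // => g /andP[_ /negPf->]; rewrite mul0r.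
Qed.

Lemma dhomog_circuit e :
  (\prod_(v in e) 'X_v : {mpoly K[n]}) \is #|e|.-homog.
Proof.
rewrite -sum1_card; elim/big_rec2: _ => [|v k p _ pk]; first exact: dhomog1.
by apply: dhomogM => //; rewrite dhomogX; apply/eqP; exact: mdeg1.
Qed.

Lemma kill_circuit A e :
  kill K A (\prod_(v in e) 'X_v) =
  if e \subset ~: A then \prod_(v in e) 'X_v else 0.
Proof.
rewrite rmorph_prod; case: ifP => [/subsetP eA|/negbT/subsetPn[v ve]].
  by apply: eq_bigr => v /eA; rewrite killX inE => /negPf->.
by rewrite inE negbK => vA; rewrite (bigD1 v) //= killX vA mul0r.
Qed.

(** Induction on [A]: [killU1_eq0] splits off a multiple of one variable at a time. *)
Lemma circuit_ideal_colon_vars D e (A : {set 'I_n}) (p : {mpoly K[n]}) :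
  (forall v, v \in A ->
     circuit_ideal K D ((\prod_(w in e) 'X_w) * 'X_v : {mpoly K[n]})) ->
  kill K A p = 0 -> circuit_ideal K D ((\prod_(w in e) 'X_w) * p).
Proof.
have [k] := ubnP #|A|; elim: k A p => // k IH A p; rewrite ltnS => cardA eA.
have [->|[v vA]] := set_0Vmem A.
  rewrite kill0 => ->; rewrite mulr0; exists (fun=> 0).
  by rewrite big1 // => f _; rewrite mul0r.
rewrite -{1}(setD1K vA) => /killU1_eq0[a pa].
rewrite -[p](subrK ('X_v * a)) mulrDr; apply: circuit_idealD.
  apply: IH pa => [|w /setD1P[_ /eA] //].
  by move: cardA; rewrite (cardsD1 v) vA.
by rewrite mulrA mulrC; apply: circuit_ideal_mull; apply: eA.
Qed.

Lemma clique_circuit C S f :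
  clique d C S -> f \subset S -> #|f| = d -> f \in C.
Proof.
case/andP=> _ /orP[ltSd fS fd|/andP[_ /forallP/(_ f)]].
  by move: ltSd; rewrite -fd ltnNge subset_leq_card.
by move=> /implyP SC fS fd; apply: SC; rewrite fS fd eqxx.
Qed.

(** Otherwise [v |: e] is a clique; a maximal clique above it contains [e], so it is [S] by
    uniqueness, and [v] lies in [S]. *)
Lemma exposed_noncircuit C e S v : #|e| = d -> exposed d C e ->
  maximal_clique d C S -> e \subset S -> v \notin S ->
  exists f, [/\ #|f| = d, f \subset v |: e & f \notin C].
Proof.
move=> ed [eC [S' [_ uniqS]]] maxS eS vS.
have [/existsP[f /and3P[/eqP]]|] :=
  boolP [exists f : {set 'I_n}, [&& #|f| == d, f \subset v |: e & f \notin C]].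
  by exists f.
rewrite negb_exists => /forallP all_circ.
have veC : clique d C (v |: e).
  apply/andP; split; first by apply/set0Pn; exists v; rewrite setU11.
  rewrite -ed subset_leq_card ?subsetUr //= ed; apply/orP; right.
  apply/forallP => f; apply/implyP => /andP[fve fd].
  by have := all_circ f; rewrite fve fd /= negbK.
have [T maxT veT] := maxset_exists veC.
have /uniqS ST : maximal_clique d C T /\ e \subset T.
  by split=> //; apply: subset_trans veT; apply: subsetUr.
have /uniqS SS : maximal_clique d C S /\ e \subset S by [].
by case/negP: vS; rewrite -SS ST; apply: subsetP veT _ _; rewrite setU11.
Qed.

Lemma exposed_colon C e S (p : {mpoly K[n]}) : #|e| = d -> exposed d C e ->
  maximal_clique d C S -> e \subset S ->
  circuit_ideal K (clutter_compl d C) ((\prod_(v in e) 'X_v) * p) <->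
  kill K (~: S) p = 0.
Proof.
move=> ed expe maxS eS; split=> [[c /(congr1 (kill K (~: S)))]|].
  (* Setting the variables outside [S] to zero fixes the monomial of [e] and kills all generators,
     since a generator supported in the clique [S] would be a circuit. *)
  rewrite rmorphM kill_circuit setCK eS rmorph_sum [RHS]big1 => [|f fC].
    move/eqP; rewrite mulf_eq0 => /orP[|/eqP//].
    rewrite prodf_seq_eq0 => /hasP[v _ /andP[_]].
    by rewrite -msupp_eq0 msuppX.
  rewrite rmorphM kill_circuit setCK; case: ifP => [fS|_]; last by rewrite mulr0.
  move: fC; rewrite !inE => /andP[fC /eqP fd].
  by rewrite (clique_circuit (maxsetp maxS) fS fd) in fC.
apply: circuit_ideal_colon_vars => v; rewrite inE => vS.
have [f [fd fve fC]] := exposed_noncircuit ed expe maxS eS vS.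
have ve : v \notin e by apply: contra vS; apply: subsetP.
(* The product is the monomial of [v |: e], a multiple of that of [f]. *)
rewrite mulrC -big_setU1 // (big_setID f) /= (setIidPr fve) mulrC.
apply: circuit_ideal_mull; apply: circuit_ideal_gen.
by rewrite !inE fC fd eqxx.
Qed.

End Clutters.

(* Induction along the removal sequence *)
Local Close Scope ring_scope.

Theorem corollary3p8 (K : fieldType) (n d : nat) (d_ge1 : (1 <= d)%N)
    (C : {set {set 'I_n}}) (r : nat)
    (e : nat -> {set 'I_n}) (Cs : nat -> {set {set 'I_n}})
    (Km : nat -> {set 'I_n})
    (Cs_first : Cs 0 = complete_clutter n d)
    (Cs_last : Cs r = C)
    (e_exposed : forall j : nat, (j < r)%N -> exposed d (Cs j) (e j))
    (Cs_step : forall j : nat, (j < r)%N -> Cs j.+1 = Cs j :\ e j)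
    (Km_clique : forall j : nat, (j < r)%N ->
       maximal_clique d (Cs j) (Km j) /\ e j \subset Km j) :
  forall i : nat,
    betti_number (circuit_ideal K (clutter_compl d C)) i
      (\sum_(j < r) 'C(n - #|Km j|, i))%N.
Proof.
(* The inclusion in the complete clutter is carried along because it yields [#|e j| = d], the degree
   of the new generator. *)
suff res j : (j <= r)%N -> Cs j \subset complete_clutter n d /\
    has_linear_resolution d (circuit_ideal K (clutter_compl d (Cs j)))
      (fun i => \sum_(l < j) 'C(n - #|Km l|, i))%N.
  move=> i; rewrite -Cs_last.
  exact: linear_resolution_betti (res r (leqnn r)).2.
elim: j => [_|j IH ltjr].
  rewrite Cs_first; split=> //.
  apply: (@eq_linear_resolution _ _ _ _ (fun=> 0%N)) => [i|].
    by rewrite big_ord0.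
  apply: zero_linear_resolution => p.
  by rewrite /clutter_compl setDv circuit_ideal0.
have [CsK resj] := IH (ltnW ltjr).
have [maxK eK] := Km_clique j ltjr; have expe := e_exposed j ltjr.
have ed : #|e j| = d by have := subsetP CsK _ expe.1; rewrite inE => /eqP.
split; first by rewrite Cs_step //; apply: subset_trans CsK; apply: subD1set.
have -> : clutter_compl d (Cs j.+1) = e j |: clutter_compl d (Cs j).
  apply/setP => f; rewrite Cs_step // !inE.
  by case: eqP => [->|_] //=; rewrite ed eqxx.
(* The Koszul ranks moved up one degree, together with the [1] in degree 0, are the binomials of
   [n - #|Km j|] over [i]. *)
apply: (@eq_linear_resolution _ _ _ _ (fun i => \sum_(l < j) 'C(n - #|Km l|, i) +
    (if i is k.+1 then 'C(#|~: Km j|, k.+1) else 1))%N).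
  move=> i; rewrite big_ord_recr /= cardsCs setCK card_ord.
  by case: i => //; rewrite bin0.
apply: linear_resolution_cone resj (linear_resolution_vars K (~: Km j)).
- by rewrite -ed; apply: dhomog_circuit.
- by move=> p; apply: exposed_colon.
- by move=> p; apply: circuit_ideal1U; rewrite !inE expe.1.
Qed.
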